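(* The $\mathbb Z_{(2)}$-module $\Delta$ is stable under each of the operators $e_0,e_1,f_0,f_1$ on $R$: for every $v\in\Delta$ one has $e_0v,\ e_1v,\ f_0v,\ f_1v\in\Delta$.
   Context: Let $R=\mathbb C[p_1,p_3,p_5,\ldots]$ be the polynomial ring in variables $p_k$ indexed by odd positive integers $k$ (this is the basic representation of the affine Lie algebra $\widehat{\mathfrak{sl}_2}$, realized on polynomials). Define operators on $R$: $\alpha_k^*$ = multiplication by $p_k$, and $\alpha_k=k\,\partial/\partial p_k$, for odd $k\ge1$; and operators $A_j$ ($j\in\mathbb Z$) by the identity of formal series in $z$ $$\sum_{j\in\mathbb Z} z^{-j}A_j=\frac12\exp\Big(-2\sum_{k\ge1\text{ odd}}\frac{p_k}{k}z^k\Big)\exp\Big(2\sum_{k\ge1\text{ odd}}\frac{\partial}{\partial p_k}z^{-k}\Big)$$ (each coefficient is a well-defined operator on $R$ since it acts on any polynomial through finitely many nonzero terms). The Chevalley generators act by $$e_0=\tfrac12(\alpha_1+A_1),\quad e_1=\tfrac12(\alpha_1-A_1),\quad f_0=\tfrac12(\alpha_1^*-A_{-1}),\quad f_1=\tfrac12(\alpha_1^*+A_{-1}).$$ Let $\mathbb Z_{(2)}=\{a/b: a,b\in\mathbb Z,\ b\text{ odd}\}$ and $\Delta=\mathbb Z_{(2)}[p_1,2p_3,4p_5,\ldots]=\mathbb Z_{(2)}[2^kp_{2k+1}:k\ge0]\subset R$. *)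

(* Defs.v *)
From HB Require Import structures.
From mathcomp Require Import all_boot all_order all_algebra.
From mathcomp Require Import finmap monalg.
From mathcomp Require Import boolp classical_sets functions cardinality fsbigop.

Set Implicit Arguments.
Unset Strict Implicit.
Unset Printing Implicit Defensive.

Import Order.TTheory GRing.Theory Num.Theory.
Local Open Scope ring_scope.

(* The ring K[p_1, p_3, p_5, ...]; the theorem is for K = C.                   *)
(* The variable of index i : nat stands for p_(2i+1).                          *)
Notation oddpoly K := {malg K[{cmonom nat}]}.

(* p_k, to be used for odd k only; k./2 is i when k = 2i+1.                    *)
Definition pvar (K : numFieldType) (k : nat) : oddpoly K := << ucm k./2 >>.

(* The partial derivative d/dp_k, to be used for odd k only.  Monomials not    *)
(* containing p_k get the coefficient 0, so divcm is only relevant when it is  *)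
(* an exact division by p_k.                                                   *)
Definition pderiv (K : numFieldType) (k : nat) (v : oddpoly K) : oddpoly K :=
  \sum_(m <- msupp v) << (v@_m *+ m k./2) *g divcm m (ucm k./2) >>.

Definition alpha (K : numFieldType) (k : nat) (v : oddpoly K) : oddpoly K :=
  k%:R *: pderiv k v.

Definition alphas (K : numFieldType) (k : nat) (v : oddpoly K) : oddpoly K :=
  pvar K k * v.

(* Formal power series, in one indeterminate, whose coefficients are operators *)
(* on V: F n is the coefficient of degree n.                                   *)
Definition opseries (V : Type) := nat -> V -> V.

Definition ops_one (V : zmodType) : opseries V :=
  fun n v => if n == 0%N then v else 0.

Definition ops_mul (V : zmodType) (F G : opseries V) : opseries V :=
  fun n v => \sum_(i < n.+1) F i (G (n - i)%N v).

Definition ops_pow (V : zmodType) (F : opseries V) (r : nat) : opseries V :=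
  iter r (ops_mul F) (@ops_one V).

(* exp F = sum_r F^r / r!, for F with zero constant coefficient: then F^r has  *)
(* no coefficient of degree < r, and the terms r > n vanish in degree n.       *)
Definition ops_exp (K : numFieldType) (V : lmodType K) (F : opseries V) :
    opseries V :=
  fun n v => \sum_(r < n.+1) (r`!%:R : K)^-1 *: ops_pow F r n v.

(* -2 * sum_(k odd) (p_k / k) z^k, as a series in z                            *)
Definition creation_exponent (K : numFieldType) : opseries (oddpoly K) :=
  fun k v => if odd k then (- 2 / k%:R) *: alphas k v else 0.

(* 2 * sum_(k odd) (d/dp_k) z^-k, as a series in z^-1                          *)
Definition annihilation_exponent (K : numFieldType) : opseries (oddpoly K) :=
  fun k v => if odd k then 2 *: pderiv k v else 0.

(* Coefficient of z^-j in                                                      *)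
(*   1/2 exp(creation_exponent) exp(annihilation_exponent).                    *)
(* The pair (n, m) contributes to z^(n - m).  Applied to v, the sum has a      *)
(* finite support, by vertex_support_finite below.                             *)
Definition vertex (K : numFieldType) (j : int) (v : oddpoly K) : oddpoly K :=
  2^-1 *: \sum_(nm \in [set nm : nat * nat | nm.2%:Z - nm.1%:Z = j]%classic)
            ops_exp (@creation_exponent K) nm.1
              (ops_exp (@annihilation_exponent K) nm.2 v).

Definition e0 (K : numFieldType) (v : oddpoly K) : oddpoly K :=
  2^-1 *: (alpha 1 v + vertex 1 v).

Definition e1 (K : numFieldType) (v : oddpoly K) : oddpoly K :=
  2^-1 *: (alpha 1 v - vertex 1 v).

Definition f0 (K : numFieldType) (v : oddpoly K) : oddpoly K :=
  2^-1 *: (alphas 1 v - vertex (-1) v).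

Definition f1 (K : numFieldType) (v : oddpoly K) : oddpoly K :=
  2^-1 *: (alphas 1 v + vertex (-1) v).

Definition Z2local (K : numFieldType) (c : K) : Prop :=
  exists a b : int, odd `|b|%N /\ c = a%:~R / b%:~R.

(* Z_(2)[2^k p_(2k+1) : k >= 0], as the subring generated in oddpoly K by      *)
(* Z_(2) and the 2^k p_(2k+1).                                                 *)
Inductive Delta (K : numFieldType) : oddpoly K -> Prop :=
| Delta_const c : Z2local c -> Delta c%:MP
| Delta_gen k : Delta (2 ^+ k *: pvar K (2 * k + 1)%N)
| Delta_add u v : Delta u -> Delta v -> Delta (u + v)
| Delta_mul u v : Delta u -> Delta v -> Delta (u * v).

Section FiniteSupport.
Variable K : numFieldType.

Local Notation wgt := (fun m : {cmonom nat} =>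
  (\sum_(i <- finsupp m) m i * (2 * i + 1))%N).

Let wgtEw (m : {cmonom nat}) (d : {fset nat}) : fsubset (finsupp m) d ->
  wgt m = (\sum_(i <- d) m i * (2 * i + 1))%N.
Proof.
move=> le; rewrite /= (big_fset_incl _ le) //= => i _.
by rewrite -cmE_eq0 => /eqP ->.
Qed.

Let wgt_divU (m : {cmonom nat}) i : m i != 0%N ->
  (wgt (divcm m (ucm i)) + (2 * i + 1) = wgt m)%N.
Proof.
move=> mi.
have im : i \in finsupp m by rewrite -cmE_neq0.
rewrite (@wgtEw (divcm m (ucm i)) (finsupp m)); last first.
  apply/fsubsetP=> j; rewrite -!cmE_neq0 divcmE.
  by apply: contraNN => /eqP ->.
rewrite (big_fsetD1 i) //= [in RHS](big_fsetD1 i) //= divcmE cmUU.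
rewrite [X in (_ + X + _)%N](_ : _ =
  (\sum_(j <- (finsupp m `\ i)%fset) m j * (2 * j + 1))%N); last first.
  rewrite !big_seq; apply: eq_bigr => j; rewrite !inE => /andP[ji _].
  by rewrite divcmE cmU eq_sym (negbTE ji) subn0.
rewrite addnAC -[X in (_ + X + _)%N]mul1n -mulnDl subnK //.
by rewrite lt0n.
Qed.

Let below (N : nat) (v : oddpoly K) := forall m, v@_m != 0 -> (wgt m < N)%N.

Let below0 N : below N 0.
Proof. by move=> m; rewrite mcoeff0 eqxx. Qed.

Let belowD N u v : below N u -> below N v -> below N (u + v).
Proof.
move=> bu bv m; rewrite mcoeffD.
have [->|/bu //] := eqVneq (u@_m) 0; rewrite add0r; exact: bv.
Qed.

Let belowZ N c v : below N v -> below N (c *: v).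
Proof. by move=> bv m; rewrite mcoeffZ mulf_eq0 negb_or => /andP[_ /bv]. Qed.

Let below_lt0 v : below 0 v -> v = 0.
Proof.
move=> bv; apply/malgP => m; rewrite mcoeff0; apply/eqP.
by apply: contraT => /bv.
Qed.

Let below_ex v : exists N, below N v.
Proof.
exists (\max_(m <- msupp v) (wgt m).+1)%N => m; rewrite mcoeff_neq0 => mv.
have := @leq_bigmax_seq _ (enum_fset (msupp v)) xpredT (fun m => (wgt m).+1) m mv isT.
by [].
Qed.

Let below_deriv N k v : odd k -> below N v -> below (N - k) (pderiv k v).
Proof.
move=> ok bv; rewrite /pderiv big_seq.
apply: (big_ind (below (N - k))) => [|u w|m mv]; first exact: below0.
- exact: belowD.
have [mk|mk] := eqVneq (m k./2) 0%N.
  by rewrite mk mulr0n monalgU0; exact: below0.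
move=> m'; rewrite mcoeffU; 
  case: (_ =P m') => [<- _|_]; last by rewrite mulr0n eqxx.
have wm : (wgt m < N)%N by apply: bv; rewrite mcoeff_neq0.
have := wgt_divU mk; have -> : (2 * k./2 + 1 = k)%N.
  by rewrite mul2n addn1 -[RHS]odd_double_half ok add1n.
by move=> wE; rewrite ltn_subRL addnC wE.
Qed.

Let lowers (F : opseries (oddpoly K)) :=
  forall n N v, below N v -> below (N - n) (F n v).

Let lowers_mul F G : lowers F -> lowers G -> lowers (ops_mul F G).
Proof.
move=> lF lG n N v bv; rewrite /ops_mul.
apply: (big_ind (below (N - n))) => [|u w|i _]; first exact: below0.
- exact: belowD.
have := lF i _ _ (lG (n - i)%N _ _ bv).
by rewrite -subnDA subnK // -ltnS.
Qed.

Let lowers_annihilation : lowers (ops_exp (@annihilation_exponent K)).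
Proof.
have lF : lowers (@annihilation_exponent K).
  move=> n N v bv; rewrite /annihilation_exponent; case: ifP => [on|_].
    by apply: belowZ; exact: below_deriv.
  exact: below0.
have lpow s : lowers (ops_pow (@annihilation_exponent K) s).
  elim: s => [|s IH]; last exact: lowers_mul.
  move=> n N v bv; rewrite /ops_pow /= /ops_one.
  by case: eqP => [->|_]; [rewrite subn0 | exact: below0].
move=> n N v bv; rewrite /ops_exp.
apply: (big_ind (below (N - n))) => [|u w|r _]; first exact: below0.
- exact: belowD.
by apply: belowZ; exact: lpow.
Qed.

Lemma annihilation_eventually0 (v : oddpoly K) :
  exists N, forall m, (N <= m)%N ->
    ops_exp (@annihilation_exponent K) m v = 0.
Proof.
have [N bv] := below_ex v; exists N => m Nm; apply: below_lt0.
by have := @lowers_annihilation m _ _ bv; rewrite (eqP (Nm : (N - m == 0)%N)).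
Qed.

Let creation_exp0 n : ops_exp (@creation_exponent K) n 0 = 0.
Proof.
have pow0 s : forall k, ops_pow (@creation_exponent K) s k 0 = 0.
  elim: s => [|s IH] k; first by rewrite /ops_pow /= /ops_one; case: ifP.
  rewrite /ops_pow iterS -/(ops_pow _ _) /ops_mul big1 // => i _.
  rewrite IH /creation_exponent; case: ifP => // _.
  by rewrite /alphas mulr0 scaler0.
by rewrite /ops_exp big1 // => r _; rewrite pow0 scaler0.
Qed.

Lemma vertex_support_finite (j : int) (v : oddpoly K) :
  finite_set [set nm : nat * nat | nm.2%:Z - nm.1%:Z = j /\
    ops_exp (@creation_exponent K) nm.1
      (ops_exp (@annihilation_exponent K) nm.2 v) != 0]%classic.
Proof.
have [N vN] := annihilation_eventually0 v.
pose g m := (`|m%:Z - j|%N, m).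
apply: (@sub_finite_set _ _ (g @` `I_N)%classic); last first.
  by apply: finite_image; exact: finite_II.
move=> [n m] [nmj /eqP nz]; have {}nmj : m%:Z - n%:Z = j := nmj.
case: (ltnP m N) => [mN|Nm].
  by exists m; [exact: mN | rewrite /g -nmj opprB addrC subrK].
case: nz; change (ops_exp (@creation_exponent K) n
  (ops_exp (@annihilation_exponent K) m v) = 0).
exact: etrans (congr1 (ops_exp (@creation_exponent K) n) (vN m Nm))
  (creation_exp0 n).
Qed.

End FiniteSupport.

(* Main.v *)
(* Write G_n and D_m for the coefficients of z^n and z^-m in the two          *)
(* exponentials, so that vertex j is 1/2 sum_(m - n = j) G_n D_m. The r-th    *)
(* divided power 2^r/r! (sum_k d/dp_k z^-k)^r obeys the Leibniz rule and      *)
(* d/dp_(2i+1) kills all generators but 2^i p_(2i+1); hence, in degree m, it  *)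
(* maps Delta into 2^((m + r)/2) Delta. As 2^r/r! is in 2 Z_(2) for r > 0,    *)
(* the r-th term of the creation exponential, in degree n, maps Delta into    *)
(* 2^(1 - (n - r)/2) Delta. So G_n D_m maps Delta into 4 Delta for n, m > 0   *)
(* and m - n = 1 or -1, and modulo 2 Delta the operators A_1 and A_-1 reduce  *)
(* to D_1/2 = alpha_1 and G_1/2 = -alphas_1.                                  *)
Require Import Defs.
From mathcomp Require Import all_boot all_order all_algebra.
From mathcomp Require Import finmap monalg complex reals.
From mathcomp Require Import boolp classical_sets cardinality fsbigop.
From mathcomp Require Import zify ring.

Set Implicit Arguments.
Unset Strict Implicit.
Unset Printing Implicit Defensive.

Import Order.TTheory GRing.Theory Num.Theory.

(** The obstacle is the factors 1/2, so the proof is a 2-adic estimate of G_n and D_m. Since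
    p_(2k+1) lies only in 2^-k Delta, G_n loses powers of 2; since d/dp_(2k+1) maps 2^k p_(2k+1) to
    2^k, D_m gains them. The gain ([scaled_annihilation_pow]) is proved by induction on the
    construction of an element of Delta, the product case being the Leibniz rule for divided powers;
    the loss ([scaled_exp_creation]) is bounded using v_2(r!) < r. On the lines m - n = 1 and m - n
    = -1 the gain wins ([scaled_creation_annihilation]). Only the pairs (n, m) = (0, 1) and (1, 0)
    escape the estimate, and they give A_1 v = alpha_1 v + 2w and A_-1 v = - p_1 v + 2x with w, x in
    Delta ([vertex1], [vertexN1]). Then e_0, e_1, f_0, f_1 send v to alpha_1 v + w, - w, p_1 v - x
    and x. *)

(** * Leibniz rule for powers of a series of derivations *)

Section SeriesOfDerivations.
Local Open Scope ring_scope.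
Variables (V : comNzRingType) (F : opseries V).
Hypothesis FD : forall k, {morph F k : u v / u + v}.
Hypothesis FM : forall k u v, F k (u * v) = F k u * v + u * F k v.

Let F0 k : F k 0 = 0.
Proof. by apply: (addrI (F k 0)); rewrite -FD !addr0. Qed.

Let F_sum k (I : Type) (s : seq I) (P : pred I) (f : I -> V) :
  F k (\sum_(i <- s | P i) f i) = \sum_(i <- s | P i) F k (f i).
Proof. exact: (big_morph (F k) (FD k) (F0 k)). Qed.

(* Truncating the series below degree N turns it into a derivation of V[X].   *)
Let D (N : nat) (p : {poly V}) := \sum_(k < N) 'X^k * map_poly (F k) p.

Let coef_D N p n : (n < N)%N -> (D N p)`_n = \sum_(i < n.+1) F i p`_(n - i).
Proof.
move=> nN; rewrite coef_sum (big_ord_widen N (fun i => F i p`_(n - i)) nN).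
rewrite [RHS]big_mkcond; apply: eq_bigr => i _.
by rewrite coefXnM ltnS; case: leqP => //= _; rewrite coef_map_id0.
Qed.

Let DD N : {morph D N : p q / p + q}.
Proof.
move=> p q; rewrite /D -big_split; apply: eq_bigr => k _ /=.
rewrite -mulrDr; congr (_ * _); apply/polyP => n.
by rewrite coefD !coef_map_id0 // coefD FD.
Qed.

Let DM N p q : D N (p * q) = D N p * q + p * D N q.
Proof.
rewrite /D mulr_suml mulr_sumr -big_split; apply: eq_bigr => k _ /=.
rewrite mulrCA -!mulrA -mulrDr; congr (_ * _); apply/polyP => n.
rewrite coefD !coefM coef_map_id0 // coefM F_sum -big_split.
by apply: eq_bigr => i _; rewrite FM !coef_map_id0.
Qed.

Let iter_D N r n u : (n < N)%N -> (iter r (D N) u%:P)`_n = ops_pow F r n u.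
Proof.
elim: r n => [|r IH] n nN; first by rewrite coefC.
rewrite iterS coef_D // /ops_pow iterS; apply: eq_bigr => i _.
by rewrite IH // (leq_ltn_trans (leq_subr _ _)).
Qed.

(** The usual binomial Leibniz rule for iterates of a single derivation, by Pascal's rule. *)
Let iter_DM N r p q : iter r (D N) (p * q) =
  \sum_(s < r.+1) (iter s (D N) p * iter (r - s) (D N) q) *+ 'C(r, s).
Proof.
have DMn m x : D N (x *+ m) = D N x *+ m.
  elim: m => [|m IH]; last by rewrite !mulrS DD IH.
  by apply: (addrI (D N 0)); rewrite -DD !addr0.
have D0 : D N 0 = 0 by have := DMn 0%N 0.
elim: r => [|r IH]; first by rewrite big_ord1 mulr1n.
rewrite iterS IH (big_morph (D N) (@DD N) D0).
under eq_bigr => s _ do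
  rewrite DMn DM mulrnDl -!iterS -(subSn (leq_ord s)).
rewrite big_split /= [RHS]big_ord_recl /= bin0.
under [X in _ = _ + X]eq_bigr => s _ do rewrite /bump add1n binS mulrnDr.
rewrite big_split /= [LHS]addrC [RHS]addrA; congr (_ + _).
rewrite big_ord_recl [in RHS]big_ord_recr /= bin0.
rewrite bin_small // mulr0n addr0; congr (_ + _).
Qed.

(** Degree n only sees the series below degree n + 1, so this is the coefficient of degree n in the
    Leibniz rule for the derivation [D n.+1] of V[X]. *)
Lemma ops_pow_leibniz r n u v : ops_pow F r n (u * v) =
  \sum_(s < r.+1)
    (\sum_(i < n.+1) ops_pow F s i u * ops_pow F (r - s) (n - i)%N v)
      *+ 'C(r, s).
Proof.
rewrite -(@iter_D n.+1) // polyCM iter_DM coef_sum; apply: eq_bigr => s _.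
rewrite coefMn coefM; congr (_ *+ _); apply: eq_bigr => i _.
by rewrite !iter_D ?ltnS ?leq_subr ?leq_ord.
Qed.

End SeriesOfDerivations.

Lemma logn2_fact_lt (n : nat) : (0 < n -> logn 2 n`! < n)%N.
Proof.
move=> n0; rewrite logn_fact //.
(* Partial sums of Legendre's formula. With x = n %/ 2 ^ m, the induction step is x/2 + max(x/2, 1)
   <= max(x, 1), halves rounded down; the 1 in the maximum makes the final inequality strict. *)
suff S m : (\sum_(1 <= k < m.+1) n %/ 2 ^ k + maxn (n %/ 2 ^ m) 1 <= n)%N.
  by have := S n; lia.
elim: m => [|m IH]; first by rewrite big_nil expn0 divn1; lia.
rewrite big_nat_recr //= expnSr divnMA; move: IH.
by set x := (n %/ 2 ^ m)%N; set s := (\sum_(_ <= _ < _) _)%N; lia.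
Qed.

(** * Multiples of Delta and their 2-adic bookkeeping *)

Section Scaled.
Local Open Scope ring_scope.
Variable K : numFieldType.
Implicit Types (a b c : K) (u v x y : oddpoly K).

Lemma Z2local_div (a b : int) : odd `|b|%N -> Z2local (a%:~R / b%:~R : K).
Proof. by exists a, b. Qed.

Lemma Z2local_int (a : int) : Z2local (a%:~R : K).
Proof. by exists a, 1; rewrite divr1. Qed.

Lemma Z2local_nat (n : nat) : Z2local (n%:R : K).
Proof. exact: (Z2local_int n). Qed.

Lemma Delta_nat (n : nat) : Delta (n%:R : oddpoly K).
Proof. by rewrite -mpolyC_nat; apply: Delta_const; exact: Z2local_nat. Qed.

Lemma Delta_scale c v : Z2local c -> Delta v -> Delta (c *: v).
Proof.
by move=> cZ dv; rewrite -mul_malgC; apply: Delta_mul => //; exact: Delta_const.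
Qed.

(** Membership in a Delta, where a may be a negative power of 2; a = 0 records that a term
    vanishes. *)
Definition scaled a x := exists2 w : oddpoly K, Delta w & x = a *: w.

Lemma scaled0 a : scaled a 0.
Proof. by exists 0; [exact: (Delta_nat 0) | rewrite scaler0]. Qed.

Lemma scaledD a x y : scaled a x -> scaled a y -> scaled a (x + y).
Proof.
move=> [u du ->] [v dv ->]; exists (u + v); first exact: Delta_add.
by rewrite scalerDr.
Qed.

Lemma scaled_sum a (I : Type) (s : seq I) (P : pred I) (f : I -> oddpoly K) :
  (forall i, P i -> scaled a (f i)) -> scaled a (\sum_(i <- s | P i) f i).
Proof.
by move=> fa; apply: big_ind => //; [exact: scaled0 | exact: scaledD].
Qed.

Lemma scaledZ a b x : scaled a x -> scaled (b * a) (b *: x).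
Proof. by case=> w dw ->; exists w; rewrite ?scalerA. Qed.

Lemma scaledM a b x y : scaled a x -> scaled b y -> scaled (a * b) (x * y).
Proof.
move=> [u du ->] [v dv ->]; exists (u * v); first exact: Delta_mul.
by rewrite -scalerAl -scalerAr scalerA.
Qed.

Lemma scaled0W a v : scaled 0 v -> scaled a v.
Proof. by case=> w _ ->; rewrite scale0r; exact: scaled0. Qed.

Lemma scaledW c a x : Z2local c -> scaled (c * a) x -> scaled a x.
Proof.
move=> cZ [w dw ->]; exists (c *: w); first exact: Delta_scale.
by rewrite scalerA mulrC.
Qed.

Lemma scaled1 v : Delta v -> scaled 1 v.
Proof. by exists v; rewrite ?scale1r. Qed.

(* The factor by which p_(n_1) ... p_(n_r), with all n_j odd and of sum n, is *)
(* multiplied in the corresponding product of generators of Delta. If n < r   *)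
(* or n - r is odd, there are no such n_j; then (wt r n)^-1 is 0 as well.     *)
Definition wt (r n : nat) : K :=
  if (r <= n)%N && ~~ odd (n - r) then 2 ^+ (n - r)./2 else 0.

Lemma wt_odd k : odd k -> wt 1 k = 2 ^+ k./2.
Proof.
by case: k => //= k ok; rewrite /wt /= subn1 /= ok uphalf_half (negbTE ok).
Qed.

Lemma wt00 : wt 0 0 = 1.
Proof. by []. Qed.

(** Exponents add when both weights are nonzero. The boolean covers the case of a zero factor on the
    left: two parity failures can cancel in [wt (r + s) (n + m)]. *)
Lemma wtM r s n m :
  exists b : bool, wt r n * wt s m = b%:R * wt (r + s) (n + m).
Proof.
rewrite /wt; case: ifP => [/andP[rn rno]|_]; last first.
  by exists false; rewrite !mul0r.
case: ifP => [/andP[sm smo]|_]; last by exists false; rewrite mulr0 mul0r.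
exists true; rewrite mul1r leq_add // subnDA -addnBAC // -addnBA // oddD.
by rewrite (negbTE rno) (negbTE smo) halfD (negbTE rno) add0n exprD.
Qed.

Lemma wtVM r s n m :
  exists b : bool, (wt r n)^-1 * (wt s m)^-1 = b%:R * (wt (r + s) (n + m))^-1.
Proof.
have [b wE] := wtM r s n m; exists b.
by rewrite -invfM wE; case: b {wE}; rewrite ?mul1r // !mul0r invr0.
Qed.

(** The 2-adic valuation of r! is at most r - 1, and its odd part is a unit of Z_(2). *)
Lemma pow2_div_fact r : (0 < r)%N ->
  exists2 c, Z2local c & 2 ^+ r / r`!%:R = 2 * c :> K.
Proof.
move=> r0; have lt_r := logn2_fact_lt r0.
have [o odd_o rE] := pfactor_coprime (isT : prime 2) (fact_gt0 r).
rewrite coprime2n in odd_o.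
exists ((2 ^ (r - (logn 2 r`!).+1))%N%:~R / o%:~R); first exact: Z2local_div.
have o0 : o%:R != 0 :> K by rewrite pnatr_eq0; case: o odd_o {rE}.
rewrite {1}rE natrM natrX -!pmulrn natrX mulrA -exprS.
have -> : (r - (logn 2 r`!).+1).+1 = (r - logn 2 r`!)%N by lia.
have p0 : 2 ^+ logn 2 r`! != 0 :> K by rewrite expf_neq0 ?pnatr_eq0.
by rewrite -{1}(subnK (ltnW lt_r)) exprD -mulf_div divff // mulr1.
Qed.

End Scaled.

(** * Reducing the Leibniz rule to monomials *)

Section MonoidAlgebra.
Local Open Scope ring_scope.

Lemma leibniz_sum (R : comNzRingType) (V : algType R) (D : V -> V)
    (I J : Type) (s : seq I) (t : seq J) (a : I -> R) (b : J -> R)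
    (f : I -> V) (g : J -> V) :
  {morph D : x y / x + y} -> (forall c x, D (c *: x) = c *: D x) ->
  (forall i j, D (f i * g j) = D (f i) * g j + f i * D (g j)) ->
  D ((\sum_(i <- s) a i *: f i) * (\sum_(j <- t) b j *: g j)) =
  D (\sum_(i <- s) a i *: f i) * (\sum_(j <- t) b j *: g j) +
  (\sum_(i <- s) a i *: f i) * D (\sum_(j <- t) b j *: g j).
Proof.
move=> DD DZ DM; have D0 : D 0 = 0 by apply: (addrI (D 0)); rewrite -DD !addr0.
have D_sum := big_morph D DD D0.
rewrite mulr_suml !D_sum !mulr_suml -big_split; apply: eq_bigr => i _ /=.
rewrite !mulr_sumr D_sum -big_split; apply: eq_bigr => j _ /=.
by rewrite !DZ -!(scalerAl, scalerAr) !DZ DM !scalerDr.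
Qed.

Lemma monalgEZ (K : choiceType) (R : nzRingType) (v : {malg R[K]}) :
  v = \sum_(m <- msupp v) v@_m *: << m >>.
Proof.
rewrite [LHS]monalgE; apply: eq_bigr => m _; apply/malgP => n.
by rewrite mcoeffZ !mcoeffU mulrnAr mulr1.
Qed.

Lemma malg_leibniz (M : conomType) (R : comNzRingType)
    (D : {malg R[M]} -> {malg R[M]}) :
  {morph D : u v / u + v} -> (forall c u, D (c *: u) = c *: D u) ->
  (forall m n : M,
    D (<< m >> * << n >>) = D << m >> * << n >> + << m >> * D << n >>) ->
  forall u v, D (u * v) = D u * v + u * D v.
Proof.
move=> DD DZ DM u v; rewrite [u]monalgEZ [v]monalgEZ.
exact: leibniz_sum.
Qed.

Lemma mul_malgCM (M : monomType) (R : nzRingType) (a b : R) (v : {malg R[M]}) :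
  (a * b)%:MP * v = a *: (b%:MP * v).
Proof. by rewrite !mul_malgC scalerA. Qed.

Lemma monalgM1 (M : monomType) (R : nzRingType) (m n : M) :
  << m >> * << n >> = << mmul m n >> :> {malg R[M]}.
Proof. by rewrite malgM_def fgmulUU mulr1. Qed.

Lemma monalgMUD (M : monomType) (R : nzRingType) (a b : R) (d1 m1 d2 m2 : M) :
  << a *g d1 >> * << m2 >> + << m1 >> * << b *g d2 >> =
  << a *g mmul d1 m2 >> + << b *g mmul m1 d2 >> :> {malg R[M]}.
Proof. by rewrite !malgM_def !fgmulUU mulr1 mul1r. Qed.

End MonoidAlgebra.

(** * The partial derivatives are derivations *)

Section PartialDerivative.
Local Open Scope ring_scope.
Variables (K : numFieldType) (k : nat).
Implicit Types (c : K) (u v : oddpoly K).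

Lemma pderivE v : pderiv k v =
  mmap (@malgC {cmonom nat} K)
    (fun m => << (m k./2)%:R *g divcm m (ucm k./2) >>) v.
Proof.
rewrite /pderiv mmapE; apply: eq_bigr => m _.
by rewrite malgM_def fgmulUU mul1m mulr_natr.
Qed.

Lemma pderivD : {morph @pderiv K k : u v / u + v}.
Proof. by move=> u v; rewrite !pderivE mmapD. Qed.

Lemma pderivU c (m : {cmonom nat}) :
  pderiv k << c *g m >> = c *: << (m k./2)%:R *g divcm m (ucm k./2) >>.
Proof. by rewrite pderivE mmapU mul_malgC. Qed.

Lemma pderivC c : pderiv k (c%:MP : oddpoly K) = 0.
Proof. by rewrite pderivU cm1 monalgU0 scaler0. Qed.

Lemma pderiv_pvar i : odd k -> odd i ->
  pderiv k (pvar K i) = (i == k)%:R.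
Proof.
move=> ok oi; rewrite pderivU scale1r cmU.
have -> : (i./2 == k./2) = (i == k) by lia.
case: eqVneq => [->|_]; last by rewrite monalgU0.
have -> : divcm (ucm k./2) (ucm k./2) = onecm nat.
  by apply/eqP/cmP => j; rewrite divcmE subnn onecmE.
exact: mpolyC1E.
Qed.

Let pderivUU (m1 m2 : {cmonom nat}) :
  << ((mulcm m1 m2) k./2)%:R *g divcm (mulcm m1 m2) (ucm k./2) >> =
  << (m1 k./2)%:R *g divcm m1 (ucm k./2) >> * << m2 >> +
  << m1 >> * << (m2 k./2)%:R *g divcm m2 (ucm k./2) >> :> oddpoly K.
Proof.
have divM (m n : {cmonom nat}) :
    << (m k./2)%:R *g divcm (mulcm m n) (ucm k./2) >> =
    << (m k./2)%:R *g mulcm (divcm m (ucm k./2)) n >> :> oddpoly K.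
  (* If p_k does not divide m, [divcm] truncates and need not commute with the product, but the
     coefficient is 0. *)
  have [->|m0] := eqVneq (m k./2) 0%N; first by rewrite !monalgU0.
  suff -> : divcm (mulcm m n) (ucm k./2) = mulcm (divcm m (ucm k./2)) n by [].
  apply/eqP/cmP => j; rewrite !(divcmE, mulcmE, cmU).
  by case: eqP => [<-|]; lia.
have mC (m n : {cmonom nat}) : mulcm m n = mulcm n m.
  by apply/eqP/cmP => j; rewrite !mulcmE addnC.
rewrite [RHS]monalgMUD mulcmE natrD monalgUD divM.
by rewrite [mulcm m1 m2]mC divM [mulcm _ m1]mC.
Qed.

Lemma pderivZ c v : pderiv k (c *: v) = c *: pderiv k v.
Proof.
rewrite !pderivE (mmapEw (msuppZ_le _ _)) mmapE scaler_sumr.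
by apply: eq_bigr => m _; rewrite mcoeffZ; exact: mul_malgCM.
Qed.

Lemma pderivX (m : {cmonom nat}) :
  pderiv k (<< m >> : oddpoly K) = << (m k./2)%:R *g divcm m (ucm k./2) >>.
Proof. by rewrite pderivU scale1r. Qed.

Let pderivXM (m n : {cmonom nat}) :
  pderiv k (<< m >> * << n >> : oddpoly K) =
  pderiv k << m >> * << n >> + << m >> * pderiv k << n >>.
Proof.
apply: etrans (congr1 (pderiv k) (monalgM1 _ m n)) _.
apply: etrans (pderivX _) _.
apply: etrans (pderivUU m n) _.
apply: (congr2 (fun x y => x * _ + _ * y)); apply: esym; exact: pderivX.
Qed.

Lemma pderivM u v : pderiv k (u * v) = pderiv k u * v + u * pderiv k v.
Proof. exact: (malg_leibniz pderivD pderivZ pderivXM). Qed.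

End PartialDerivative.

(** * Powers of 2 lost by the creation exponential *)

Section Exponentials.
Local Open Scope ring_scope.

Lemma ops_powS (V : zmodType) (F : opseries V) r n v :
  ops_pow F r.+1 n v = \sum_(i < n.+1) F i (ops_pow F r (n - i)%N v).
Proof. by []. Qed.

Lemma scale_mul_scale (R : comNzRingType) (V : algType R) (a b : R) (x y : V) :
  a *: (x * (b *: y)) = b *: (a *: (x * y)).
Proof. by rewrite -scalerAr !scalerA mulrC. Qed.

Variable K : numFieldType.
Implicit Types (a b c : K) (u v : oddpoly K).

Lemma double_half_add1 k : odd k -> (2 * k./2 + 1)%N = k.
Proof. by lia. Qed.

Lemma Delta_pvar k : odd k -> Delta (wt K 1 k *: pvar K k).
Proof.
by move=> ok; rewrite wt_odd // -{2}(double_half_add1 ok); exact: Delta_gen.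
Qed.

Lemma scaled_pvar k : odd k -> scaled (wt K 1 k)^-1 (pvar K k).
Proof.
move=> ok; exists (wt K 1 k *: pvar K k); first exact: Delta_pvar.
by rewrite scalerA mulVf ?scale1r // wt_odd // expf_neq0 ?pnatr_eq0.
Qed.

Lemma creation_exponentZ k c v :
  creation_exponent k (c *: v) = c *: creation_exponent k v.
Proof.
rewrite /creation_exponent; case: (odd k); last by rewrite scaler0.
exact: scale_mul_scale.
Qed.

Lemma scaled_creation k v :
  Delta v -> scaled (2 * (wt K 1 k)^-1) (creation_exponent k v).
Proof.
move=> dv; rewrite /creation_exponent; case: ifP => ok; last exact: scaled0.
have /scaledM/(_ (scaled1 dv)) := scaled_pvar ok.
rewrite mulr1 => /(scaledZ (-2 / k%:R)).
have -> : -2 / k%:R * (wt K 1 k)^-1 =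
    (-1)%:~R / (Posz k)%:~R * (2 * (wt K 1 k)^-1) :> K.
  by rewrite rmorphN rmorph1 -pmulrn mulrA [_ * 2]mulrAC mulN1r.
exact: scaledW (Z2local_div K (-1) (b := Posz k) ok).
Qed.

Lemma scaled_creation_pow r n v :
  Delta v -> scaled (2 ^+ r * (wt K r n)^-1)
    (ops_pow (@creation_exponent K) r n v).
Proof.
move=> dv; elim: r n => [|r IH] n.
  rewrite /ops_pow /= /ops_one; case: eqP => [->|_]; last exact: scaled0.
  by rewrite wt00 invr1 mulr1; exact: scaled1.
rewrite ops_powS; apply: scaled_sum => i _; have [w dw ->] := IH (n - i)%N.
rewrite creation_exponentZ.
have := scaledZ (2 ^+ r * (wt K r (n - i))^-1) (scaled_creation i dw).
have [b bE] := wtVM K 1 r i (n - i).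
have -> : 2 ^+ r * (wt K r (n - i))^-1 * (2 * (wt K 1 i)^-1) =
    b%:R * (2 ^+ r.+1 * (wt K r.+1 n)^-1).
  by rewrite mulrACA -exprSr [_^-1 * _]mulrC bE subnKC ?leq_ord // mulrCA.
by apply: scaledW; exact: Z2local_nat.
Qed.

Lemma ops_exp0 (V : lmodType K) (F : opseries V) x : ops_exp F 0 x = x.
Proof. by rewrite /ops_exp big_ord1 /ops_pow /= invr1 scale1r. Qed.

Lemma ops_exp1 (V : lmodType K) (F : opseries V) x :
  F 0%N 0 = 0 -> ops_exp F 1 x = F 1%N x.
Proof.
move=> F00; rewrite /ops_exp 2!big_ord_recl big_ord0 /ops_pow /= /ops_one /=.
rewrite /ops_mul 2!big_ord_recl big_ord0 /= F00.
by rewrite !(invr1, scale1r, add0r, addr0).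
Qed.

Lemma ops_exp_creation1 v :
  ops_exp (@creation_exponent K) 1 v = - 2 *: alphas 1 v.
Proof.
rewrite ops_exp1; last by [].
exact: (congr1 (fun a => a *: alphas 1 v) (divr1 _)).
Qed.

Lemma scaled_exp_creation n v : (0 < n)%N -> Delta v ->
  scaled (2 / 2 ^+ n.-1./2) (ops_exp (@creation_exponent K) n v).
Proof.
move=> n0 dv; rewrite /ops_exp; apply: scaled_sum => -[[|r] /= rn] _.
  by rewrite /ops_pow /= /ops_one gtn_eqF // scaler0; exact: scaled0.
have := scaledZ (r.+1)`!%:R^-1 (scaled_creation_pow r.+1 n dv).
have [c cZ cE] := pow2_div_fact K (ltn0Sn r).
rewrite mulrA [_^-1 * _]mulrC cE /wt.
case: ifP => [_|_]; last first.
  by rewrite invr0 mulr0; exact: scaled0W.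
(* The loss e is largest for the linear term of the exponential, where it equals f. *)
set e := (n - r.+1)./2; set f := n.-1./2.
have -> : 2 * c * (2 ^+ e)^-1 = c * ((2 ^ (f - e))%N%:R * (2 / 2 ^+ f)).
  have ef : (e <= f)%N by apply: half_leq; lia.
  rewrite natrX -{2}(subnK ef) exprD.
  by field; rewrite !expf_neq0 ?pnatr_eq0.
by move=> H; apply: scaledW (scaledW _ H) => //; exact: Z2local_nat.
Qed.

(** * Powers of 2 gained by the annihilation exponential *)

Lemma annihilation_exponentD k :
  {morph @annihilation_exponent K k : u v / u + v}.
Proof.
move=> u v; rewrite /annihilation_exponent.
case: (odd k); last by rewrite addr0.
exact: (etrans (congr1 _ (pderivD k u v)) (scalerDr _ _ _)).
Qed.

Lemma scale_leibniz (R : comNzRingType) (V : algType R) (a : R)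
    (x x' y y' : V) :
  a *: (x' * y + x * y') = (a *: x') * y + x * (a *: y').
Proof. by rewrite scalerDr scalerAl scalerAr. Qed.

Lemma annihilation_exponentM k u v :
  annihilation_exponent k (u * v) =
  annihilation_exponent k u * v + u * annihilation_exponent k v.
Proof.
rewrite /annihilation_exponent; case: (odd k).
  exact: (etrans (congr1 _ (pderivM k u v)) (scale_leibniz _ _ _ _ _)).
by rewrite mul0r mulr0 addr0.
Qed.

Lemma annihilation_exponentC k c :
  annihilation_exponent k (c%:MP : oddpoly K) = 0.
Proof.
by rewrite /annihilation_exponent pderivC scaler0; case: (odd k).
Qed.

Lemma annihilation_powD r n :
  {morph ops_pow (@annihilation_exponent K) r n : u v / u + v}.
Proof.
move=> u v; elim: r n => [|r IH] n.
  by rewrite /ops_pow /= /ops_one; case: (n == 0)%N; rewrite ?addr0.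
rewrite !ops_powS -big_split; apply: eq_bigr => i _ /=.
exact: etrans (congr1 _ (IH _)) (annihilation_exponentD _ _ _).
Qed.

Lemma annihilation_exponent0 k : annihilation_exponent k (0 : oddpoly K) = 0.
Proof. by have := annihilation_exponentC k 0; rewrite malgC0E. Qed.

Lemma annihilation_pow1 n v :
  ops_pow (@annihilation_exponent K) 1 n v = annihilation_exponent n v.
Proof.
rewrite ops_powS big_ord_recr /= subnn big1 ?add0r // => i _.
rewrite /ops_pow /= /ops_one gtn_eqF ?subn_gt0 //.
exact: annihilation_exponent0.
Qed.

Lemma annihilation_powC r n c :
  ops_pow (@annihilation_exponent K) r.+1 n (c%:MP : oddpoly K) = 0.
Proof.
elim: r n => [|r IH] n.
  by rewrite annihilation_pow1 annihilation_exponentC.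
rewrite ops_powS; apply: big1 => i _.
by rewrite IH annihilation_exponent0.
Qed.

Lemma annihilation_pow_affine v (f : nat -> K) :
  (forall k, annihilation_exponent k v = (f k)%:MP) ->
  forall r n, ops_pow (@annihilation_exponent K) r.+2 n v = 0.
Proof.
move=> fE; elim=> [|r IH] n; rewrite ops_powS; apply: big1 => i _.
  by rewrite annihilation_pow1 fE annihilation_exponentC.
by rewrite IH annihilation_exponent0.
Qed.

(** Dividing by r! absorbs the binomials, so divided powers of a product need no further
    denominators. *)
Lemma divided_leibniz (V : algType K) (r n : nat) (f g : nat -> nat -> V) :
  r`!%:R^-1 *: \sum_(s < r.+1)
    (\sum_(i < n.+1) f s i * g (r - s)%N (n - i)%N) *+ 'C(r, s) =
  \sum_(s < r.+1) \sum_(i < n.+1) (s`!%:R^-1 *: f s i) *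
    ((r - s)`!%:R^-1 *: g (r - s)%N (n - i)%N).
Proof.
have f0 l : l`!%:R != 0 :> K by rewrite pnatr_eq0 -lt0n fact_gt0.
rewrite scaler_sumr; apply: eq_bigr => s _.
rewrite -scaler_nat scalerA scaler_sumr; apply: eq_bigr => i _.
rewrite -scalerAl -scalerAr scalerA -(bin_fact (leq_ord s)) !natrM.
have c0 : 'C(r, s)%:R != 0 :> K by rewrite pnatr_eq0 -lt0n bin_gt0 leq_ord.
by congr (_ *: _); field; rewrite c0 !f0.
Qed.

(** Constants are killed by positive powers; a generator has constant derivatives, so only r <= 1
    matters; for products the weights multiply by [wtM]. *)
Lemma scaled_annihilation_pow r n v : Delta v ->
  scaled (2 ^+ r * wt K r n)
    (r`!%:R^-1 *: ops_pow (@annihilation_exponent K) r n v).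
Proof.
move=> dv; elim: dv r n => {v}.
- move=> c cZ [|r] n; last by rewrite annihilation_powC scaler0; exact: scaled0.
  rewrite invr1 scale1r /ops_pow /= /ops_one.
  case: eqP => [->|_]; last exact: scaled0.
  by rewrite wt00 mulr1; apply: scaled1; exact: Delta_const.
- move=> k [|r] n.
    rewrite invr1 scale1r /ops_pow /= /ops_one.
    case: eqP => [->|_]; last exact: scaled0.
    by rewrite wt00 mulr1; apply: scaled1; exact: Delta_gen.
  have ok : odd (2 * k + 1) by lia.
  have kE : (2 * k + 1)./2 = k by lia.
  have F1 m : annihilation_exponent m (2 ^+ k *: pvar K (2 * k + 1)) =
      (if m == (2 * k + 1)%N then 2 ^+ k.+1 else 0)%:MP.
    rewrite /annihilation_exponent pderivZ scalerA -exprS.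
    case: ifP => [om|em].
      rewrite pderiv_pvar // eq_sym; case: eqP => _; last first.
        by rewrite scaler0 malgC0E.
      by rewrite -mul_malgC mulr1.
    by case: eqP em => [->|]; rewrite ?ok ?malgC0E.
  case: r => [|r].
    rewrite invr1 scale1r annihilation_pow1 F1.
    case: eqP => [->|_]; last by rewrite malgC0E; exact: scaled0.
    rewrite wt_odd // kE -exprS -[_%:MP]mulr1 mul_malgC.
    by exists 1; first exact: (Delta_nat K 1).
  by rewrite (annihilation_pow_affine F1) scaler0; exact: scaled0.
- move=> u v _ IHu _ IHv r n.
  rewrite (etrans (congr1 _ (annihilation_powD r n u v)) (scalerDr _ _ _)).
  exact: (scaledD (IHu r n) (IHv r n)).
move=> u v _ IHu _ IHv r n.
rewrite (ops_pow_leibniz annihilation_exponentD annihilation_exponentM).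
pose P w s i := ops_pow (@annihilation_exponent K) s i w.
rewrite [X in scaled _ X](divided_leibniz r n (P u) (P v)).
apply: scaled_sum => s _; apply: scaled_sum => i _.
have := scaledM (IHu s i) (IHv (r - s)%N (n - i)%N).
have [b bE] := wtM K s (r - s) i (n - i).
have -> : 2 ^+ s * wt K s i * (2 ^+ (r - s) * wt K (r - s) (n - i)) =
    b%:R * (2 ^+ r * wt K r n).
  by rewrite mulrACA bE -exprD !subnKC ?leq_ord // mulrCA.
by apply: scaledW; exact: Z2local_nat.
Qed.

Lemma ops_exp_annihilation1 v :
  ops_exp (@annihilation_exponent K) 1 v = 2 *: pderiv 1 v.
Proof. by rewrite ops_exp1. Qed.

Lemma scaled_exp_annihilation m v : (0 < m)%N -> Delta v ->
  scaled (2 ^+ (m./2).+1) (ops_exp (@annihilation_exponent K) m v).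
Proof.
move=> m0 dv; rewrite /ops_exp; apply: scaled_sum => -[[|r] /= rm] _.
  by rewrite /ops_pow /= /ops_one gtn_eqF // scaler0; exact: scaled0.
have := scaled_annihilation_pow r.+1 m dv; rewrite /wt.
case: ifP => [/andP[rm' rmo]|_]; last first.
  by rewrite mulr0; exact: scaled0W.
(* Here e is half of m plus the order of the power. That order is positive and has the parity of m,
   hence is at least 2 when m is even. *)
rewrite -exprD; set e := (_ + _)%N; have le : (m./2.+1 <= e)%N.
  by rewrite /e; lia.
rewrite -(subnK le) exprD -natrX.
by apply: scaledW; exact: Z2local_nat.
Qed.

End Exponentials.

(** * The vertex operator modulo 2 Delta and the Chevalley generators *)

Section Vertex.
Local Open Scope ring_scope.
Variable K : numFieldType.
Implicit Types (a b c : K) (u v : oddpoly K).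

Lemma scaled_fsum_sub (T : choiceType) (S : set T) (f : T -> oddpoly K) x0 a :
  finite_set [set x | S x /\ f x != 0]%classic -> S x0 ->
  (forall x, S x -> x != x0 -> scaled a (f x)) ->
  scaled a (\sum_(x \in S) f x - f x0).
Proof.
move=> fin Sx0 fa; rewrite fsbig_supp.
have -> : (S `&` f @^-1` [set~ 0] = [set x | S x /\ f x != 0])%classic.
  by apply/seteqP; split=> x /= [Sx /eqP].
rewrite fsbig_finite //; set A := fset_set _.
have inA x : x \in A -> S x by rewrite in_fset_set // inE => -[].
have [x0A|x0A] := boolP (x0 \in A).
  rewrite (big_fsetD1 x0) //= (addrC (f x0)) addrK big_seq.
  apply: scaled_sum => x.
  by rewrite !inE => /andP[x0x /inA Sx]; exact: fa.
(* The distinguished index may lie outside the finite support. *)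
have -> : f x0 = 0.
  by apply: contraNeq x0A => f0; rewrite in_fset_set // inE.
rewrite subr0 big_seq; apply: scaled_sum => x xA; apply: fa; first exact: inA.
by apply: contraNneq x0A => <-.
Qed.

Let two_neq0 : 2 != 0 :> K.
Proof. by rewrite pnatr_eq0. Qed.

Lemma Delta_alpha1 v : Delta v -> Delta (alpha 1 v).
Proof.
move=> dv; rewrite /alpha scale1r.
(* D_1 = 2 d/dp_1 maps Delta into 2 Delta; cancel the 2. *)
have [w dw] := scaled_exp_annihilation (ltn0Sn 0) dv.
by rewrite ops_exp_annihilation1 expr1 => /(scalerI two_neq0) ->.
Qed.

Lemma vertex_sub_leading (n0 m0 : nat) v :
  (forall n m, (m + n0 = n + m0)%N -> (n, m) != (n0, m0) ->
    scaled 4 (ops_exp (@creation_exponent K) n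
               (ops_exp (@annihilation_exponent K) m v))) ->
  scaled 2 (vertex (m0%:Z - n0%:Z) v -
    2^-1 *: ops_exp (@creation_exponent K) n0
              (ops_exp (@annihilation_exponent K) m0 v)).
Proof.
move=> H; rewrite /vertex -scalerBr.
have E : 2^-1 * 4 = 2 :> K by field.
rewrite -[X in scaled X _]E.
apply: scaledZ; apply: (scaled_fsum_sub (x0 := (n0, m0))) => //.
  exact: vertex_support_finite.
move=> [n m] /= nmE; apply: H; lia.
Qed.

Lemma ops_exp_creationZ n c v :
  ops_exp (@creation_exponent K) n (c *: v) =
  c *: ops_exp (@creation_exponent K) n v.
Proof.
have powZ r m : ops_pow (@creation_exponent K) r m (c *: v) =
    c *: ops_pow (@creation_exponent K) r m v.
  elim: r m => [|r IH] m.
    by rewrite /ops_pow /= /ops_one; case: ifP; rewrite ?scaler0.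
  rewrite !ops_powS scaler_sumr; apply: eq_bigr => i _.
  by rewrite -creation_exponentZ [X in creation_exponent i X]IH.
rewrite /ops_exp scaler_sumr; apply: eq_bigr => r _.
by rewrite powZ !scalerA mulrC.
Qed.

(** The total exponent of 2 is (m/2 + 1) + (1 - (n - 1)/2), halves rounded down, so the assumed
    inequality leaves at least 2. *)
Lemma scaled_creation_annihilation n m v :
  (0 < n)%N -> (0 < m)%N -> (n.-1./2 <= m./2)%N -> Delta v ->
  scaled 4 (ops_exp (@creation_exponent K) n
             (ops_exp (@annihilation_exponent K) m v)).
Proof.
move=> n0 m0 fg dv; have [w dw wE] := scaled_exp_annihilation m0 dv.
rewrite (etrans (congr1 _ wE) (ops_exp_creationZ _ _ _)).
have := scaledZ (2 ^+ (m./2).+1) (scaled_exp_creation n0 dw).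
have -> : 2 ^+ (m./2).+1 * (2 / 2 ^+ n.-1./2) =
    (2 ^ (m./2 - n.-1./2))%N%:R * 4 :> K.
  rewrite natrX exprS -{1}(subnK fg) exprD.
  by field; rewrite expf_neq0 ?pnatr_eq0.
by apply: scaledW; exact: Z2local_nat.
Qed.

Lemma scale_half2 (V : lmodType K) (x : V) : 2^-1 *: (2 *: x) = x.
Proof. by rewrite scalerA mulVf // scale1r. Qed.

Lemma scale_half_opp2 (V : lmodType K) (x : V) : - (2^-1 *: (- 2 *: x)) = x.
Proof. by rewrite scaleNr scalerN opprK scale_half2. Qed.

Lemma vertex1 v : Delta v -> scaled 2 (vertex 1 v - alpha 1 v).
Proof.
move=> dv.
have E : 2^-1 *: ops_exp (@creation_exponent K) 0
    (ops_exp (@annihilation_exponent K) 1 v) = alpha 1 v.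
  apply: etrans (esym (scale1r _)).
  apply: etrans (scale_half2 _); apply: (congr1 ( *:%R _)).
  exact: etrans (ops_exp0 _ _) (ops_exp_annihilation1 v).
(* On m = n + 1, the pair (0, 1) is the only one with a zero entry. *)
rewrite -E {E}; apply: (@vertex_sub_leading 0 1) => n m nm nm01.
have n0 : (0 < n)%N.
  rewrite lt0n; apply: contraNneq nm01 => nE.
  suff -> : m = 1%N by rewrite nE.
  by move: nm; rewrite nE addn0.
apply: scaled_creation_annihilation => //; lia.
Qed.

Lemma vertexN1 v : Delta v -> scaled 2 (vertex (-1) v + alphas 1 v).
Proof.
move=> dv.
have E : - (2^-1 *: ops_exp (@creation_exponent K) 1
    (ops_exp (@annihilation_exponent K) 0 v)) = alphas 1 v.
  apply: etrans (scale_half_opp2 _); apply: (congr1 (fun y => - (2^-1 *: y))).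
  exact: etrans (congr1 _ (ops_exp0 _ v)) (ops_exp_creation1 v).
rewrite -E {E}; apply: (@vertex_sub_leading 1 0) => n m nm nm10.
have m0 : (0 < m)%N.
  rewrite lt0n; apply: contraNneq nm10 => mE.
  suff -> : n = 1%N by rewrite mE.
  by move: nm; rewrite mE addn0.
apply: scaled_creation_annihilation => //; lia.
Qed.

Lemma Delta_opp v : Delta v -> Delta (- v).
Proof.
move=> dv; rewrite -scaleN1r; apply: Delta_scale dv.
exact: (Z2local_int K (-1)).
Qed.

Lemma Delta_alphas1 v : Delta v -> Delta (alphas 1 v).
Proof.
move=> dv; apply: Delta_mul dv.
by rewrite -[pvar K 1]scale1r; exact: (Delta_gen K 0).
Qed.

Lemma half_add_sub (V : lmodType K) (x y w : V) : y - x = 2 *: w ->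
  2^-1 *: (x + y) = x + w /\ 2^-1 *: (x - y) = - w.
Proof.
move=> yE; split; last by rewrite -opprB yE scalerN scale_half2.
by rewrite -(subrK x y) yE addrCA -mulr2n -scaler_nat -scalerDr scale_half2
  addrC.
Qed.

Lemma Delta_stable v :
  Delta v -> Delta (e0 v) /\ Delta (e1 v) /\ Delta (f0 v) /\ Delta (f1 v).
Proof.
move=> dv; have da := Delta_alpha1 dv; have ds := Delta_alphas1 dv.
have [w dw /half_add_sub[e0E e1E]] := vertex1 dv.
have [x dx xE] := vertexN1 dv.
(* The leading part of [vertex (-1)] is [- alphas 1], so the halving lemma is applied to its
   opposite. *)
have /half_add_sub[f0E f1E] : - vertex (-1) v - alphas 1 v = 2 *: - x.
  by rewrite scalerN -xE opprD.
rewrite !opprK in f1E.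
have -> : e0 v = alpha 1 v + w := e0E.
have -> : e1 v = - w := e1E.
have -> : f0 v = alphas 1 v - x := f0E.
have -> : f1 v = x := f1E.
split; [exact: Delta_add | split; [exact: Delta_opp | split => //]].
exact: (Delta_add ds (Delta_opp dx)).
Qed.

End Vertex.

Local Open Scope complex_scope.

Theorem theorem3p4 (R : realType) (v : oddpoly R[i]) :
  Delta v -> Delta (e0 v) /\ Delta (e1 v) /\ Delta (f0 v) /\ Delta (f1 v).
Proof. exact: Delta_stable. Qed.
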